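(* (Uniform Low Basis Theorem) $\mathsf{C}_{\{0,1\}^{\mathbb{N}}}$ is low computable.
   Context: Baire space is $\mathbb{N}^{\mathbb{N}}$, with its usual product topology and the canonical countable tupling $\langle p_0,p_1,p_2,\ldots\rangle$ on it. Computability of partial functions $F:\subseteq\mathbb{N}^{\mathbb{N}}\to\mathbb{N}^{\mathbb{N}}$ is meant via (type-2) Turing machines. A representation of a set $X$ is a surjective partial function $\delta:\subseteq\mathbb{N}^{\mathbb{N}}\to X$; $(X,\delta)$ is a represented space. A partial multi-valued function $f:\subseteq X\rightrightarrows Y$ is $(\delta_X,\delta_Y)$-computable if there is a computable $F:\subseteq\mathbb{N}^{\mathbb{N}}\to\mathbb{N}^{\mathbb{N}}$ with $\delta_YF(p)\in f\delta_X(p)$ for all $p\in\mathrm{dom}(f\delta_X)$. $\{0,1\}^{\mathbb{N}}$ is represented by the restricted identity. $\mathcal{A}_-(\{0,1\}^{\mathbb{N}})$ is the set of closed subsets of Cantor space with the representation $\psi_-$ in which $p$ names $A$ iff $p$ is a (potentially empty) enumeration of words $w_i\in\{0,1\}^*$ with $A=\{0,1\}^{\mathbb{N}}\setminus\bigcup_i w_i\{0,1\}^{\mathbb{N}}$. Closed choice is $\mathsf{C}_{\{0,1\}^{\mathbb{N}}}:\subseteq\mathcal{A}_-(\{0,1\}^{\mathbb{N}})\rightrightarrows\{0,1\}^{\mathbb{N}},\ A\mapsto A$ with domain the non-empty closed sets (any point of $A$ is an admissible output). Let $(U_n)_{n\in\mathbb{N}}$ be a standard enumeration of the c.e. open subsets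 of $\mathbb{N}^{\mathbb{N}}$ (e.g. $U_n=\bigcup_{w\in W_n}w\mathbb{N}^{\mathbb{N}}$ with $W_n$ the $n$-th c.e. set of finite words over $\mathbb{N}$). The Turing jump operator $J:\mathbb{N}^{\mathbb{N}}\to\mathbb{N}^{\mathbb{N}}$ is $J(p)(n)=1$ if $p\in U_n$ and $J(p)(n)=0$ otherwise; it is injective and $J^{-1}$ denotes its partial inverse. $\lim:\subseteq\mathbb{N}^{\mathbb{N}}\to\mathbb{N}^{\mathbb{N}}$, $\langle p_0,p_1,\ldots\rangle\mapsto\lim_{i\to\infty}p_i$ (usual Baire topology). For a represented space $(X,\delta)$ the low representation is $\delta^\vee:=\delta\circ J^{-1}\circ\lim$. $f:\subseteq X\rightrightarrows Y$ is low computable if it is $(\delta_X,\delta_Y^\vee)$-computable. *)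

(* Defs.v *)
From HB Require Import structures.
From mathcomp Require Import all_boot all_order all_algebra.
From mathcomp Require Import all_classical all_reals all_analysis.

Set Implicit Arguments.
Unset Strict Implicit.
Unset Printing Implicit Defensive.

Local Open Scope classical_set_scope.

(* The library's topology on nat is the discrete one. *)
Definition baire : Type := prod_topology (fun _ : nat => nat).
HB.instance Definition _ := Topological.on baire.

Definition cylinder (T : Type) (w : seq T) : set (nat -> T) :=
  [set x | mkseq x (size w) = w].

Inductive move := Left | Stay | Right.

(* A machine has a read-only one-way infinite input tape over {0,1}, finitely
   many two-way infinite work tapes (indexed by the finite type tape), and a
   write-only one-way output tape over {0,1}, to which each step appends at
   most one bit.  There is no halting state: a type-2 machine computes an
   infinite output. *)
Record machine := Machine {
  state : finType;
  symbol : finType;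
  tape : finType;
  start : state;
  blank : symbol;
  transition : state -> bool -> {ffun tape -> symbol} ->
    state * move * {ffun tape -> symbol * move} * option bool
}.

Record config (M : machine) := Config {
  cur_state : state M;
  input_head : nat;
  work_head : tape M -> int;
  work_cell : tape M -> int -> symbol M;
  output : seq bool
}.

(* A sequence p is written on a tape as 1^(p 0) 0 1^(p 1) 0 1^(p 2) 0 ... *)
Definition unary (p : baire) (n : nat) : seq bool :=
  flatten (mkseq (fun i => rcons (nseq (p i) true) false) n).

(* Each block has length at least 1, so k.+1 blocks reach cell k. *)
Definition input_cell (p : baire) (k : nat) : bool :=
  nth false (unary p k.+1) k.

(* The input head stays put when it is asked to move left from cell 0. *)
Definition move_nat (m : move) (k : nat) : nat :=
  match m with Left => k.-1 | Stay => k | Right => k.+1 end.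

Definition move_int (m : move) (z : int) : int :=
  match m with Left => z - 1 | Stay => z | Right => z + 1 end%R.

Definition init (M : machine) : config M :=
  Config (start M) 0 (fun=> 0%R) (fun _ _ => blank M) [::].

Definition step (M : machine) (p : baire) (c : config M) : config M :=
  let: (s, m, w, o) :=
    transition (cur_state c) (input_cell p (input_head c))
      [ffun k => work_cell c k (work_head c k)] in
  Config s
    (move_nat m (input_head c))
    (fun k => move_int (w k).2 (work_head c k))
    (fun k z => if z == work_head c k then (w k).1 else work_cell c k z)
    (if o is Some b then rcons (output c) b else output c).

(* On input p, machine M runs forever and writes q on its output tape.  The
   output only ever grows, so q is determined by M and p. *)
Definition writes (M : machine) (p q : baire) : Prop :=
  forall n, exists t, prefix (unary q n) (output (iter t (step p) (init M))).

(* Partial functions are given by their graphs.  The machine is unconstrained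
   outside the domain of F. *)
Definition computable (F : baire -> baire -> Prop) : Prop :=
  exists M, forall p q, F p q -> writes M p q.

(* The constant zero input carries no information. *)
Definition computable_point (q : baire) : Prop :=
  exists M, writes M (fun=> 0) q.

(* naming p x reads "p is a name of x"; that is, the graph of a partial
   function from Baire space to X. *)
Definition naming (X : Type) := baire -> X -> Prop.

Record representation (X : Type) := Representation {
  names :> naming X;
  names_functional : forall p x y, names p x -> names p y -> x = y;
  names_surjective : forall x, exists p, names p x
}.

(* A multi-valued f is given by its graph; its domain is [set x | f x !=set0]. *)
Definition mv_computable (X Y : Type) (dX : naming X) (dY : naming Y)
    (f : X -> set Y) : Prop :=
  exists2 F : baire -> baire -> Prop, computable F &
    forall p x, dX p x -> f x !=set0 ->
      exists q y, [/\ F p q, dY q y & f x y].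

(* Value 0 of p enumerates nothing, value k.+1 enumerates the element with
   code k; so p may enumerate the empty set. *)
Definition enumerates (T : Type) (code : T -> nat) (p : baire) (W : set T) :
    Prop :=
  range p `\ 0 = [set (code w).+1 | w in W].

Definition binary_word_code (w : seq bool) : nat :=
  CodeSeq.code (map nat_of_bool w).

Definition indexed_word_code (nw : nat * seq nat) : nat :=
  CodeSeq.code (nw.1 :: nw.2).

Definition ce (W : set (nat * seq nat)) : Prop :=
  exists2 q, computable_point q & enumerates indexed_word_code q W.

(* V n is the union of the cylinders w N^N with w in the n-th section of a
   c.e. set, i.e. (V n)_n is a computable sequence of c.e. open sets. *)
Definition uniformly_ce_open (V : nat -> set baire) : Prop :=
  exists2 W, ce W &
    forall n, V n = \bigcup_(w in [set w | W (n, w)]) cylinder w.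

(* A standard enumeration of the c.e. open sets is an acceptable one: it is
   uniformly c.e. open, and indices of any such sequence can be computed (as
   for W_n by the s-m-n theorem).  With V constant the second clause says that
   each c.e. open set occurs.  A computable function s : nat -> nat is the same
   as a computable point of Baire space. *)
Definition standard_enumeration (U : nat -> set baire) : Prop :=
  uniformly_ce_open U /\
  forall V, uniformly_ce_open V ->
    exists2 s : baire, computable_point s & forall k, V k = U (s k).

Definition jump (U : nat -> set baire) (p : baire) : baire :=
  fun n => nat_of_bool (p \in U n).

Definition cantor_pair (i n : nat) : nat := ((i + n) * (i + n).+1)./2 + n.

(* The i-th component of p = <p_0, p_1, ...>, where p_i n is stored at the
   index <i, n>; the pairing is bijective, so every p is such a tuple. *)
Definition component (p : baire) (i : nat) : baire :=
  fun n => p (cantor_pair i n).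

Definition lim_graph (p q : baire) : Prop := component p @ \oo --> q.

(* The composition of the partial functions d, J^-1 and lim. *)
Definition low (U : nat -> set baire) (X : Type) (d : naming X) : naming X :=
  fun p x => exists q, lim_graph p (jump U q) /\ d q x.

Definition low_computable (U : nat -> set baire) (X Y : Type)
    (dX : representation X) (dY : representation Y) (f : X -> set Y) : Prop :=
  mv_computable dX (low U dY) f.

Definition cantor_names : naming cantor_space :=
  fun p x => p = (fun n => nat_of_bool (x n)).

Definition closed_cantor := {A : set cantor_space | closed A}.

Definition psi_minus_names : naming closed_cantor :=
  fun p A => exists2 W : set (seq bool), enumerates binary_word_code p W &
    sval A = ~` \bigcup_(w in W) cylinder w.

Lemma cantor_names_functional p x y :
  cantor_names p x -> cantor_names p y -> x = y.
Proof.
move=> -> e; apply/funext => n; have /= := congr1 (fun f : baire => f n) e.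
by case: (x n); case: (y n).
Qed.

Lemma cantor_names_surjective x : exists p, cantor_names p x.
Proof. by eexists. Qed.

Definition cantor_representation : representation cantor_space :=
  Representation cantor_names_functional cantor_names_surjective.

Lemma binary_word_code_inj : injective binary_word_code.
Proof.
apply: (inj_comp (can_inj CodeSeq.codeK)); apply: inj_map.
by case; case.
Qed.

Lemma psi_minus_functional p A B :
  psi_minus_names p A -> psi_minus_names p B -> A = B.
Proof.
move=> [W pW AE] [W' pW' BE].
have WW' : W = W'.
  have sub (V V' : set (seq bool)) : enumerates binary_word_code p V ->
      enumerates binary_word_code p V' -> V `<=` V'.
    rewrite /enumerates => -> e w Vw.
    have : [set (binary_word_code w).+1 | w in V] (binary_word_code w).+1.
      by exists w.
    by rewrite e => -[w' ? [/binary_word_code_inj <-]].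
  by apply/seteqP; split; exact: sub.
case: A B AE BE => [A cA] [B cB] /= AE BE.
by apply: eq_exist; rewrite AE BE WW'.
Qed.

Lemma open_cylinder (O : set cantor_space) x :
  open O -> O x -> exists n, cylinder (mkseq x n) `<=` O.
Proof.
move=> oO Ox; apply: contrapT => /forallNP H.
have {}H n : exists y : cantor_space, cylinder (mkseq x n) y /\ ~ O y.
  by have /existsNP[y /not_implyP] := H n; exists y.
have [y Hy] := choice H.
have yx : y @ \oo --> x.
  apply/cvg_sup => i; apply/cvg_image.
    by apply/seteqP; split => // b _; exists (fun=> b).
  move=> V /=; rewrite nbhs_principalE => /principal_filterP Vxi.
  exists [set z : cantor_space | V (z i)]; last first.
    by apply/seteqP; split => [b [z ? <-] //|b Vb]; exists (fun=> b).
  exists i.+1 => // n /= lt_in.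
  have [+ _] := Hy n; rewrite /cylinder /= size_mkseq => /(congr1 (nth false ^~ i)).
  by rewrite !nth_mkseq// => ->.
have [N _ HN] := yx _ (open_nbhs_nbhs (conj oO Ox)).
by have [_] := Hy N; apply; apply: HN => /=.
Qed.

Lemma psi_minus_surjective A : exists p, psi_minus_names p A.
Proof.
case: A => A cA.
pose W : set (seq bool) := [set w | cylinder w `<=` ~` A].
pose C := [set (binary_word_code w).+1 | w in W].
exists (fun i => if i \in C then i else 0), W => /=.
  apply/seteqP; split => [k [[i _ <-]] /=|k Ck].
    by case: ifPn => [/set_mem|_] // + _; apply.
  split; last by case: Ck => w _ <-.
  by exists k => //; rewrite mem_set.
apply/seteqP; split => [x Ax [w Ww wx]|x nWx].
  exact: Ww wx Ax.
apply: contrapT => nAx; apply: nWx.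
have [||n nA] := @open_cylinder (~` A) x => //; first exact: closed_openC.
by exists (mkseq x n) => //; rewrite /cylinder /= size_mkseq.
Qed.

Definition psi_minus : representation closed_cantor :=
  Representation psi_minus_functional psi_minus_surjective.

(* Its domain, where the value is nonempty, is the nonempty closed sets. *)
Definition closed_choice_cantor (A : closed_cantor) : set cantor_space :=
  sval A.

(* Main.v *)
Require Import Defs.
From mathcomp Require Import all_boot all_classical all_analysis.
From mathcomp Require Import all_algebra zify.

Set Implicit Arguments.
Unset Strict Implicit.
Unset Printing Implicit Defensive.

(** The idea is the forcing proof of the low basis theorem, carried out with
    finite approximations.  Let A be the nonempty closed set named by p.  Go
    through the open sets U 0, U 1, ... and remove U n from what is left of
    A whenever something remains after the removal.  By compactness some
    point a survives all the removals.  If U n was removed then a is not in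
    U n; if it was not, then what was left of A lay inside U n, and so a is
    in U n.  Hence the jump of a at n is the answer h n to the question
    whether U n had to be kept, and it does not matter which surviving point
    a is.

    The question is not decidable, but it can be decided in the limit.
    After d steps only finitely many words have been enumerated into the
    complement of A and into the sets U m, and whether they cover Cantor
    space can be tested on words of length d; the guess for n uses the
    current guesses for all m < n.  Once these are final, the guess for n
    can only change from false to true, so it has a limit h n.  At every
    stage some word is left over by A and the removals made so far; by the
    fan theorem, which is the compactness of Cantor space, some point a is
    left over by all of them, and so the sequence of all guesses converges
    to the jump of a.  This combinatorial part is low_basis (from
    fan_theorem and guesses_stabilize); guessP says that the computed
    guesses satisfy its hypothesis.

    It remains to compute the guesses on a machine.  They form a primitive
    recursive function answer of the stage d and of a number that codes all
    that was read by then, namely d cells of the input tape and d steps of a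
    machine E that enumerates the sets U n (definable_answer).  Primitive
    recursive functions run on counter machines (the lemmas on definable), a
    counter machine can evaluate such a function again at every stage and
    print the values (stagewise_program), and a machine with one tape per
    counter can simulate the counter machine and E side by side
    (simulates_step).  The outcome is writes_stagewise. *)

(** * Counter programs *)

(** A loop is entered through Dec, whose second argument is the length of
    the jump taken at zero.  Tick is the only access to the outside world:
    it asks for the next of a sequence of numbers that the environment
    supplies. *)
Inductive instr :=
  | Inc of nat
  | Dec of nat & nat
  | Back of nat
  | Emit of bool
  | Tick.

Record store := Store { reg : nat -> nat; time : nat; out : seq bool }.

Definition upd (rho : nat -> nat) (x n : nat) : nat -> nat :=
  fun y => if y == x then n else rho y.

Definition fetch (prog : seq instr) (pc : nat) : instr := nth (Back 0) prog pc.

Section Semantics.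
Variable v : nat -> nat.

(** The value v t of the t-th tick is delivered as a jump: v t <= 8, and the
    jump skips all but v t of the eight instructions that follow.  This
    keeps the effect of every instruction on a register a single increment. *)
Definition next (i : instr) (pc : nat) (s : store) : nat * store :=
  let: Store rho t o := s in
  match i with
  | Inc x => (pc.+1, Store (upd rho x (rho x).+1) t o)
  | Dec x j => if rho x == 0 then (pc + j, s)
               else (pc.+1, Store (upd rho x (rho x).-1) t o)
  | Back j => (pc - j, s)
  | Emit b => (pc.+1, Store rho t (rcons o b))
  | Tick => (pc + (9 - v t), Store rho t.+1 o)
  end.

Definition run_step prog (c : 'I_(size prog).+1 * store) :
    'I_(size prog).+1 * store :=
  let: (pc, s) := next (fetch prog c.1) c.1 c.2 in (inord pc, s).

Definition reaches prog (c c' : 'I_(size prog).+1 * store) : Prop :=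
  exists k, iter k (@run_step prog) c = c'.

Lemma reaches_refl prog c : @reaches prog c c.
Proof. by exists 0. Qed.

Lemma reaches_trans prog c1 c2 c3 :
  @reaches prog c1 c2 -> reaches c2 c3 -> reaches c1 c3.
Proof. by move=> [k <-] [l <-]; exists (l + k); rewrite iterD. Qed.

(** Jumps are relative, so the meaning of a piece of code does not depend on
    the place o where it sits in the program. *)
Definition loaded (prog : seq instr) (o : nat) (code : seq instr) : Prop :=
  o + size code <= size prog /\
  forall i, i < size code -> fetch prog (o + i) = fetch code i.

Lemma loaded_cat prog o c1 c2 : loaded prog o (c1 ++ c2) ->
  loaded prog o c1 /\ loaded prog (o + size c1) c2.
Proof.
rewrite /loaded size_cat => -[le_o H]; split; split; try by lia.
  move=> i lt_i; rewrite H; last by lia.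
  by rewrite /fetch nth_cat lt_i.
move=> i lt_i; rewrite -addnA H; last by lia.
by rewrite /fetch nth_cat ltnNge leq_addr /= addKn.
Qed.

(** A big-step judgment that needs no syntax of structured programs: it
    speaks of the code itself, run inside any program. *)
Definition exec (code : seq instr) (s s' : store) : Prop :=
  forall prog o, loaded prog o code ->
    @reaches prog (inord o, s) (inord (o + size code), s').

Lemma exec_nil s : exec [::] s s.
Proof. by move=> prog o _; rewrite addn0; exact: reaches_refl. Qed.

Lemma exec_cat c1 c2 s1 s2 s3 :
  exec c1 s1 s2 -> exec c2 s2 s3 -> exec (c1 ++ c2) s1 s3.
Proof.
move=> e1 e2 prog o /loaded_cat[l1 l2]; rewrite size_cat addnA.
exact: reaches_trans (e1 _ _ l1) (e2 _ _ l2).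
Qed.

Lemma loaded_step prog o i code s :
  loaded prog o (i :: code) ->
  run_step (prog := prog) (inord o, s) =
    let: (pc, s') := next i o s in (inord pc, s').
Proof.
move=> [/= le_o H]; rewrite /run_step /= inordK; last by lia.
by have := H 0 isT; rewrite addn0 => ->.
Qed.

Lemma exec_instr i s s' :
  (forall pc, next i pc s = (pc.+1, s')) -> exec [:: i] s s'.
Proof.
by move=> H prog o l; exists 1; rewrite /= (loaded_step _ l) H addn1.
Qed.

Lemma exec_cons i c s1 s2 s3 :
  (forall pc, next i pc s1 = (pc.+1, s2)) -> exec c s2 s3 -> exec (i :: c) s1 s3.
Proof. by move=> /exec_instr e1 e2; exact: (exec_cat e1 e2). Qed.

Definition while (x : nat) (c : seq instr) : seq instr :=
  Dec x (size c + 2) :: c ++ [:: Back (size c).+1].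

Lemma exec_while0 x c s : reg s x = 0 -> exec (while x c) s s.
Proof.
move=> sx prog o l; exists 1; rewrite /= (loaded_step _ l).
by case: s sx => rho t out' /= ->; rewrite /= size_cat /= addn1 addn2.
Qed.

Lemma exec_whileS x c rho t o s1 s2 : rho x != 0 ->
  exec c (Store (upd rho x (rho x).-1) t o) s1 -> exec (while x c) s1 s2 ->
  exec (while x c) (Store rho t o) s2.
Proof.
move=> rx e1 e2 prog pc l; apply: reaches_trans (e2 _ _ l).
have [lD] := loaded_cat (l : loaded _ _ ([:: Dec x (size c + 2)] ++ _)).
move=> /loaded_cat[lc lB].
apply: (@reaches_trans _ _ (inord (pc + 1), Store (upd rho x (rho x).-1) t o)).
  by exists 1; rewrite /= (loaded_step _ lD) /= (negPf rx) addn1.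
apply: reaches_trans (e1 _ _ lc) _.
exists 1; rewrite /= (loaded_step _ lB); case: (s1) => r1 t1 o1 /=.
by congr (inord _, _); lia.
Qed.

End Semantics.

(** Pure computations: they behave in the same way whatever the ticks
    deliver. *)
Definition calc (code : seq instr) (rho rho' : nat -> nat) : Prop :=
  forall v t o, exec v code (Store rho t o) (Store rho' t o).

Lemma calc_cat c1 c2 r1 r2 r3 :
  calc c1 r1 r2 -> calc c2 r2 r3 -> calc (c1 ++ c2) r1 r3.
Proof. by move=> e1 e2 v t o; exact: exec_cat (e1 v t o) (e2 v t o). Qed.

Lemma calc_nil r : calc [::] r r.
Proof. by move=> v t o; exact: exec_nil. Qed.

Lemma calc_inc x r : calc [:: Inc x] r (upd r x (r x).+1).
Proof. by move=> v t o; apply: exec_instr. Qed.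

(** The index k of the invariant is the value of the loop counter, hence the
    number of rounds still to go. *)
Lemma calc_while x c (I : nat -> (nat -> nat) -> Prop) :
  (forall k r, I k r -> r x = k) ->
  (forall k r, I k.+1 r -> exists2 r', calc c (upd r x k) r' & I k r') ->
  forall k r, I k r -> exists2 r', calc (while x c) r r' & I 0 r'.
Proof.
move=> Ix step; elim=> [|k IH] r Ir.
  by exists r => // v t o; apply: exec_while0 => /=; exact: Ix.
have [r1 e1 I1] := step _ _ Ir; have [r2 e2 I2] := IH _ I1.
exists r2 => // v t o; have rx := Ix _ _ Ir.
by apply: (exec_whileS _ _ (e2 v t o)); rewrite rx //=; exact: e1.
Qed.

Definition clear x := while x [::].

Lemma calc_clear x r : calc (clear x) r (upd r x 0).
Proof.
have [|k r1 ->||r' e E] := @calc_while x [::]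
    (fun k r' => r' = upd r x k) _ _ (r x) r.
- by move=> k r1 ->; rewrite /upd eqxx.
- exists (upd r x k) => //; suff -> : upd (upd r x k.+1) x k = upd r x k.
    exact: calc_nil.
  by apply/funext => y; rewrite /upd; case: eqP.
- by apply/funext => y; rewrite /upd; case: eqP => // ->.
- by rewrite E in e.
Qed.

Lemma upd_eq rho x n : upd rho x n x = n.
Proof. by rewrite /upd eqxx. Qed.

Lemma upd_neq rho x y n : y != x -> upd rho x n y = rho y.
Proof. by rewrite /upd => /negPf ->. Qed.

Lemma calc_eq c r1 r2 r3 : calc c r1 r2 -> r2 =1 r3 -> calc c r1 r3.
Proof. by move=> + /funext <-. Qed.

Ltac upd_tac :=
  let z := fresh "z" in
  move=> z; rewrite /upd; repeat case: eqP => ?; subst; try congruence; lia.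

Definition pour x y := while x [:: Inc y].

Lemma calc_pour (x y : nat) r : x != y ->
  calc (pour x y) r (upd (upd r y (r x + r y)) x 0).
Proof.
move=> /eqP xy.
have [|k r1 [lt_k E]||r' e [_ E]] := @calc_while x [:: Inc y]
    (fun k r' => k <= r x /\ r' =1 upd (upd r y (r x - k + r y)) x k)
    _ _ (r x) r.
- by move=> k r1 [_ ->]; rewrite upd_eq.
- eexists; first exact: calc_inc.
  by split; [lia | move=> z; rewrite /upd !E; move: z; upd_tac].
- by split => //; upd_tac.
- by apply: calc_eq e _ => z; rewrite E; move: z; upd_tac.
Qed.

(** The counter x is destroyed by the loop that reads it and is restored
    from the second copy z. *)
Definition copy x y z :=
  clear y ++ clear z ++ while x [:: Inc y; Inc z] ++ pour z x.

Lemma calc_copy (x y z : nat) r : x != y -> x != z -> y != z ->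
  calc (copy x y z) r (upd (upd r y (r x)) z 0).
Proof.
move=> /eqP xy /eqP xz /eqP yz.
have [|k r1 [lt_k E]||r' e [_ E]] := @calc_while x [:: Inc y; Inc z]
    (fun k r' => k <= r x /\
       r' =1 upd (upd (upd r y (r x - k)) z (r x - k)) x k)
    _ _ (r x) (upd (upd r y 0) z 0).
- by move=> k r1 [_ ->]; rewrite upd_eq.
- eexists; first exact: (calc_cat (@calc_inc y _) (@calc_inc z _)).
  by split; [lia | move=> u; rewrite /upd !E; move: u; upd_tac].
- by split => //; upd_tac.
- apply: calc_cat (@calc_clear _ _) _; apply: calc_cat (@calc_clear _ _) _.
  apply: calc_cat e _; apply: calc_eq (calc_pour _ _) _; first exact/eqP/nesym.
  by move=> u; rewrite /upd !E; move: u; upd_tac.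
Qed.

(** * Primitive recursive functions run on counter programs *)

(** The function f of a point x of T is computed from the values at x of the
    functions in the context G, which registers r provide.  The result goes
    to register n, and all registers from n on are free for scratch work.
    Contexts of functions rather than argument vectors let f be written in
    the ordinary way, as a function of a variable x. *)
Definition definable (T : Type) (G : seq (T -> nat)) (f : T -> nat) : Prop :=
  forall r n, size r = size G -> all (fun x => x < n) r ->
  exists code, forall x rho, map rho r = map (fun g => g x) G ->
    exists rho', [/\ calc code rho rho', rho' n = f x &
                     forall j, j < n -> rho' j = rho j].

(** The context under one more binder, whose variable is the second
    component. *)
Definition extend (T : Type) (G : seq (T -> nat)) : seq (T * nat -> nat) :=
  snd :: map (fun g y => g y.1) G.

Section Definable.
Variable T : Type.
Implicit Types (G : seq (T -> nat)) (f g h : T -> nat).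

Lemma map_eq_in_lt r n (rho rho' : nat -> nat) : all (fun x => x < n) r ->
  (forall j, j < n -> rho' j = rho j) -> map rho' r = map rho r.
Proof. by move=> /allP H E; apply/eq_in_map => j /H /E. Qed.

Lemma all_lt_leq r n m : all (fun x => x < n) r -> n <= m ->
  all (fun x => x < m) r.
Proof. by move=> H le_nm; apply: sub_all H => x /leq_trans; apply. Qed.

Lemma definable_var G k : k < size G ->
  definable G (fun x => nth (fun=> 0) G k x).
Proof.
move=> lt_k r n sz lt_r; exists (copy (nth 0 r k) n n.+1) => x rho E.
have lt_rk : nth 0 r k < n by move/all_nthP: lt_r; apply; rewrite sz.
exists (upd (upd rho n (rho (nth 0 r k))) n.+1 0); split.
- by apply: calc_copy; lia.
- rewrite upd_neq ?upd_eq; last by lia.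
  rewrite -(nth_map 0 0 rho) ?sz // E (nth_map (fun=> 0)) //.
- by move=> j lt_j; rewrite !upd_neq //; lia.
Qed.

Lemma definable_zero G : definable G (fun=> 0).
Proof.
move=> r n sz lt_r; exists (clear n) => x rho E; exists (upd rho n 0); split.
- exact: calc_clear.
- exact: upd_eq.
- by move=> j lt_j; rewrite upd_neq //; lia.
Qed.

Lemma definable_succ G f : definable G f -> definable G (fun x => (f x).+1).
Proof.
move=> df r n sz lt_r; have [c H] := df r n sz lt_r.
exists (c ++ [:: Inc n]) => x rho E; have [rho' [e En Ej]] := H x rho E.
exists (upd rho' n (rho' n).+1); split.
- exact: calc_cat e (@calc_inc _ _).
- by rewrite upd_eq En.
- by move=> j lt_j; rewrite upd_neq ?Ej //; lia.
Qed.

Lemma definable_weaken G f :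
  definable G f -> definable (extend G) (fun y => f y.1).
Proof.
move=> df [|x0 r] n //= [sz] /andP[_ lt_r].
rewrite size_map in sz; have [c H] := df r n sz lt_r.
exists c => y rho [_ E]; have [|rho' H'] := H y.1 rho; last by exists rho'.
by rewrite E -map_comp.
Qed.

(** Primitive recursion.  Registers n, n + 1 and n + 2 hold the number of
    rounds left, the accumulator and the index of the round. *)
Lemma definable_iteri G f g (h : T -> nat -> nat -> nat) :
  definable G f -> definable G g ->
  definable (extend (extend G)) (fun y => h y.1.1 y.1.2 y.2) ->
  definable G (fun x => iteri (g x) (h x) (f x)).
Proof.
move=> df dg dh r n sz lt_r.
have [cg Hg] := dg r n sz lt_r.
have lt_r1 := all_lt_leq lt_r (leqnSn n).
have [cf Hf] := df r n.+1 sz lt_r1.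
have [|| ch Hh] := dh (n.+1 :: n.+2 :: r) n.+3.
- by rewrite /= !size_map sz.
- by rewrite /= (all_lt_leq lt_r); lia.
exists (cg ++ cf ++ clear n.+2 ++
  while n (ch ++ clear n.+1 ++ pour n.+3 n.+1 ++ [:: Inc n.+2]) ++ pour n.+1 n).
move=> x rho E.
have [rg [eg Eg Jg]] := Hg x rho E.
have [|rf [ef Ef Jf]] := Hf x rg; first by rewrite (map_eq_in_lt lt_r Jg).
have fgE : rf n = g x by rewrite Jf.
have Jfg j : j < n -> rf j = rho j by move=> lt_j; rewrite Jf ?Jg //; lia.
have [|k r1 [le_k E1 E2 E3 J1]||r' e [_ E1 E2 E3 J1]] := @calc_while n
  (ch ++ clear n.+1 ++ pour n.+3 n.+1 ++ [:: Inc n.+2])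
  (fun k r' => [/\ k <= g x, r' n = k, r' n.+1 = iteri (g x - k) (h x) (f x),
    r' n.+2 = g x - k & forall j, j < n -> r' j = rho j]) _ _ (g x) (upd rf n.+2 0).
- by move=> k r1 [].
- have [|r2 [eh Eh Jh]] := Hh (x, g x - k.+1, r1 n.+1) (upd r1 n k).
    rewrite /= !upd_neq ?E3; try by lia.
    congr [:: _, _ & _]; rewrite -!map_comp -E; apply: map_eq_in_lt lt_r _.
    by move=> j lt_j; rewrite upd_neq ?J1 //; lia.
  eexists.
    apply: calc_cat eh _; apply: calc_cat (@calc_clear _ _) _.
    by apply: calc_cat (calc_pour _ _) (@calc_inc _ _); lia.
  have sub : g x - k = (g x - k.+1).+1 by lia.
  split.
  + by lia.
  + by rewrite !upd_neq ?Jh ?upd_eq //; lia.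
  + rewrite sub /= -E2 -Eh /upd; repeat case: eqP => ?; lia.
  + by rewrite upd_eq !upd_neq ?Jh ?upd_neq ?E3 -?sub //; lia.
  + by move=> j lt_j; rewrite !upd_neq ?Jh ?upd_neq ?J1 //; lia.
- split => //; first by rewrite upd_neq //; lia.
  + by rewrite upd_neq ?Ef ?subnn //; lia.
  + by rewrite upd_eq subnn.
  + by move=> j lt_j; rewrite upd_neq ?Jfg //; lia.
eexists; split.
- apply: calc_cat eg _; apply: calc_cat ef _.
  apply: calc_cat (@calc_clear _ _) _; apply: calc_cat e _.
  by apply: calc_pour; lia.
- by rewrite upd_neq ?upd_eq ?E1 ?E2 ?subn0 ?addn0 //; lia.
- by move=> j lt_j; rewrite !upd_neq ?J1 //; lia.
Qed.

Lemma definable_ext G f g : definable G f -> f =1 g -> definable G g.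
Proof. by move=> + /funext <-. Qed.

End Definable.

Create HintDb definable.
#[export] Hint Resolve definable_zero definable_succ definable_iteri : definable.

(** Closes the leaves of a definability proof: a variable of the context, or
    a function known to be definable, possibly below up to three binders.
    The inner nodes are handled by the lemmas in the hint database. *)
Ltac definable_leaf :=
  match goal with
  | H : definable _ _ |- _ =>
      first [exact H | exact (definable_weaken H)
            | exact (definable_weaken (definable_weaken H))
            | exact (definable_weaken (definable_weaken (definable_weaken H)))]
  | |- @definable _ ?G _ =>
      first [exact (@definable_var _ G 0 isT) | exact (@definable_var _ G 1 isT)
            | exact (@definable_var _ G 2 isT) | exact (@definable_var _ G 3 isT)
            | exact (@definable_var _ G 4 isT) | exact (@definable_var _ G 5 isT)
            | exact (@definable_var _ G 6 isT)]
  end.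
#[export] Hint Extern 0 (definable _ _) => definable_leaf : definable.

Lemma definable_const T (G : seq (T -> nat)) n : definable G (fun=> n).
Proof. by elim: n => [|n]; auto 20 with definable. Qed.
#[export] Hint Resolve definable_const : definable.

Lemma definable_add T (G : seq (T -> nat)) f g : definable G f -> definable G g ->
  definable G (fun x => f x + g x).
Proof.
move=> df dg.
apply: (@definable_ext _ _ (fun x => iteri (g x) (fun _ a => a.+1) (f x))).
  by auto 20 with definable.
by move=> x; elim: (g x) => [|n /= ->]; rewrite ?addn0 ?addnS.
Qed.
#[export] Hint Resolve definable_add : definable.

Lemma definable_pred T (G : seq (T -> nat)) f :
  definable G f -> definable G (fun x => (f x).-1).
Proof.
move=> df.
apply: (@definable_ext _ _ (fun x => iteri (f x) (fun i _ => i) 0)).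
  by auto 20 with definable.
by move=> x; case: (f x).
Qed.
#[export] Hint Resolve definable_pred : definable.

Lemma definable_sub T (G : seq (T -> nat)) f g : definable G f -> definable G g ->
  definable G (fun x => f x - g x).
Proof.
move=> df dg.
apply: (@definable_ext _ _ (fun x => iteri (g x) (fun _ a => a.-1) (f x))).
  by auto 20 with definable.
by move=> x; elim: (g x) => [|n /= ->]; rewrite ?subn0 ?subnS.
Qed.
#[export] Hint Resolve definable_sub : definable.

Lemma definable_mul T (G : seq (T -> nat)) f g : definable G f -> definable G g ->
  definable G (fun x => f x * g x).
Proof.
move=> df dg.
apply: (@definable_ext _ _ (fun x => iteri (g x) (fun _ a => f x + a) 0)).
  by auto 20 with definable.
by move=> x; elim: (g x) => [|n /= ->]; rewrite ?muln0 ?mulnS.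
Qed.
#[export] Hint Resolve definable_mul : definable.

Lemma definable_exp T (G : seq (T -> nat)) f g : definable G f -> definable G g ->
  definable G (fun x => f x ^ g x).
Proof.
move=> df dg.
apply: (@definable_ext _ _ (fun x => iteri (g x) (fun _ a => f x * a) 1)).
  by auto 20 with definable.
by move=> x; elim: (g x) => [|n /= ->]; rewrite ?expn0 ?expnS.
Qed.
#[export] Hint Resolve definable_exp : definable.

Lemma definable_negb T (G : seq (T -> nat)) (b : T -> bool) :
  definable G (fun x => b x : nat) ->
  definable G (fun x => ~~ b x : nat).
Proof.
move=> db; apply: (@definable_ext _ _ (fun x => 1 - b x)).
  by auto 20 with definable.
by move=> x; case: (b x).
Qed.
#[export] Hint Resolve definable_negb : definable.

Lemma definable_andb T (G : seq (T -> nat)) (b c : T -> bool) :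
  definable G (fun x => b x : nat) -> definable G (fun x => c x : nat) ->
  definable G (fun x => b x && c x : nat).
Proof.
move=> db dc; apply: (@definable_ext _ _ (fun x => b x * c x)).
  by auto 20 with definable.
by move=> x; case: (b x); case: (c x).
Qed.
#[export] Hint Resolve definable_andb : definable.

Lemma definable_orb T (G : seq (T -> nat)) (b c : T -> bool) :
  definable G (fun x => b x : nat) -> definable G (fun x => c x : nat) ->
  definable G (fun x => b x || c x : nat).
Proof.
move=> db dc; apply: (@definable_ext _ _ (fun x => 1 - (1 - (b x + c x)))).
  by auto 20 with definable.
by move=> x; case: (b x); case: (c x).
Qed.
#[export] Hint Resolve definable_orb : definable.

Lemma definable_eq T (G : seq (T -> nat)) f g : definable G f -> definable G g ->
  definable G (fun x => f x == g x : nat).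
Proof.
move=> df dg.
apply: (@definable_ext _ _ (fun x => 1 - ((f x - g x) + (g x - f x)))).
  by auto 20 with definable.
by move=> x; case: eqP; lia.
Qed.
#[export] Hint Resolve definable_eq : definable.

Lemma definable_if T (G : seq (T -> nat)) (b : T -> bool) f g :
  definable G (fun x => b x : nat) ->
  definable G f -> definable G g ->
  definable G (fun x => if b x then f x else g x).
Proof.
move=> db df dg.
apply: (@definable_ext _ _ (fun x => iteri (b x) (fun _ _ => f x) (g x))).
  by auto 20 with definable.
by move=> x; case: (b x).
Qed.
#[export] Hint Resolve definable_if : definable.

Lemma iotaSr n : iota 0 n.+1 = rcons (iota 0 n) n.
Proof. by rewrite -addn1 iotaD cats1. Qed.

(** The quotient of k + 1 exceeds that of k, say a, exactly when k + 1 = (a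
    + 1) y; this also gives 0 for y = 0. *)
Lemma definable_div T (G : seq (T -> nat)) f g : definable G f -> definable G g ->
  definable G (fun x => f x %/ g x).
Proof.
move=> df dg.
apply: (@definable_ext _ _ (fun x =>
  iteri (f x) (fun k a => a + (k.+1 == a.+1 * g x)) 0)).
  by auto 20 with definable.
move=> x; case: (posnP (g x)) => [->|g0].
  by rewrite divn0; elim: (f x) => //= n ->; rewrite muln0.
elim: (f x) => [|n /= ->]; rewrite ?div0n // (divnS _ g0) addnC; congr (_ + _).
suff -> : (g x %| n.+1) = (n.+1 == (n %/ g x).+1 * g x) by [].
apply/idP/eqP => [dv|->]; last exact: dvdn_mull.
by rewrite -[LHS](divnK dv) divnS // dv.
Qed.
#[export] Hint Resolve definable_div : definable.

Lemma definable_has T (G : seq (T -> nat)) (P : T -> nat -> bool) f :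
  definable G f ->
  definable (extend G) (fun y => P y.1 y.2 : nat) ->
  definable G (fun x => has (P x) (iota 0 (f x)) : nat).
Proof.
move=> df dP.
have dP2 : definable (extend (extend G)) (fun y => P y.1.1 y.1.2 : nat).
  exact: (definable_weaken dP).
apply: (@definable_ext _ _ (fun x =>
  iteri (f x) (fun i a => 1 - (1 - (P x i + a))) 0)).
  by auto 20 with definable.
move=> x; elim: (f x) => // n IH; rewrite iotaSr has_rcons /= IH.
by case: has; case: (P x n).
Qed.
#[export] Hint Resolve definable_has : definable.

Lemma definable_all T (G : seq (T -> nat)) (P : T -> nat -> bool) f :
  definable G f ->
  definable (extend G) (fun y => P y.1 y.2 : nat) ->
  definable G (fun x => all (P x) (iota 0 (f x)) : nat).
Proof.
move=> df dP.
have dP2 : definable (extend (extend G)) (fun y => P y.1.1 y.1.2 : nat).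
  exact: (definable_weaken dP).
apply: (@definable_ext _ _ (fun x =>
  iteri (f x) (fun i a => P x i * a) 1)).
  by auto 20 with definable.
move=> x; elim: (f x) => // n IH; rewrite iotaSr all_rcons /= IH.
by case: all; case: (P x n).
Qed.
#[export] Hint Resolve definable_all : definable.

Lemma definable_mod T (G : seq (T -> nat)) f g : definable G f ->
  definable G g -> definable G (fun x => f x %% g x).
Proof.
move=> df dg; apply: (@definable_ext _ _ (fun x => f x - f x %/ g x * g x)).
  by auto 20 with definable.
by move=> x; rewrite {1}(divn_eq (f x) (g x)) addKn.
Qed.
#[export] Hint Resolve definable_mod : definable.

Lemma definable_half T (G : seq (T -> nat)) f : definable G f ->
  definable G (fun x => (f x)./2).
Proof.
move=> df; apply: (@definable_ext _ _ (fun x => f x %/ 2)).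
  by auto 20 with definable.
by move=> x; rewrite divn2.
Qed.
#[export] Hint Resolve definable_half : definable.

(** * Numbers as digit sequences *)

Definition digit (b x k : nat) : nat := (x %/ b ^ k) %% b.

Definition encode (b : nat) (s : seq nat) : nat :=
  foldr (fun v h => v + b * h) 0 s.

Lemma encode_rcons b s v :
  encode b (rcons s v) = encode b s + v * b ^ size s.
Proof.
elim: s => [|w s IH] /=; first by rewrite muln0 addn0 expn0 muln1.
by rewrite IH expnS; nia.
Qed.

Lemma digit_encode b s k : all (fun v => v < b) s ->
  digit b (encode b s) k = nth 0 s k.
Proof.
rewrite /digit; elim: s k => [|w s IH] k /=; first by rewrite div0n mod0n nth_nil.
case/andP=> lt_w H; have b0 : 0 < b by lia.
case: k => [|k]; first by rewrite expn0 divn1 addnC mulnC modnMDl modn_small.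
by rewrite expnS divnMA addnC [b * _]mulnC divnMDl // (divn_small lt_w) addn0 IH.
Qed.

Lemma encode_lt b s : all (fun v => v < b) s -> encode b s < b ^ size s.
Proof.
elim: s => [|w s IH] //= /andP[lt_w /IH]; rewrite expnS; nia.
Qed.

(** * The guesses as a primitive recursive function *)

(** A history is a number in base 9 whose k-th digit reports on step k.  In
    base 3 that digit has two digits, one for each of the two tracks: track
    0 for the input tape and track 1 for the output of the enumerating
    machine.  On a track 0 stands for no bit, 1 for the bit false and 2 for
    the bit true. *)
Definition track (q H k : nat) : nat := digit 3 (digit 9 H k) q.

(** The length of the block of ones that is being read before step k. *)
Definition run (q H k : nat) : nat :=
  iteri k (fun i r =>
    if track q H i == 2 then r.+1 else if track q H i == 1 then 0 else r) 0.

(** In the unary notation 1^v 0 a value v is complete at the step that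
    delivers 0. *)
Definition emitted (q H d v : nat) : bool :=
  has (fun k => (track q H k == 1) && (run q H k == v)) (iota 0 d).

(** The code of the word formed by the binary digits 0, ..., j - 1 of x.
    The recursion defining the code of a word consumes the last letter
    first. *)
Definition prefix_code (x j : nat) : nat :=
  iteri j (fun i c => 2 ^ digit 2 x (j.-1 - i) * (2 * c + 1)) 0.

(** By stage d the word x of length d is known to lie outside the closed
    set. *)
Definition outside (H d x : nat) : bool :=
  has (fun j => emitted 0 H d (prefix_code x j).+1) (iota 0 d.+1).

(** By stage d the word x of length d is known to lie in the m-th open set:
    the number 2^m (2 c + 1) is the code of the list m :: w if c is the code
    of w. *)
Definition inside (H d m x : nat) : bool :=
  has (fun j => emitted 1 H d (2 ^ m * (2 * prefix_code x j + 1)).+1)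
    (iota 0 d.+1).

(** Bit m of g is the guess for m < n; the sets with guess 0 have been
    removed.  The test asks whether removing the n-th open set as well
    leaves no word of length d. *)
Definition covered (H d n g : nat) : bool :=
  all (fun x => outside H d x ||
     has (fun m => ((m == n) || (digit 2 g m == 0)) && inside H d m x)
       (iota 0 n.+1)) (iota 0 (2 ^ d)).

(** Since the guess for n depends on all earlier ones, the recursion carries
    them along, as the bits of one number. *)
Definition guesses (H d n : nat) : nat :=
  iteri n (fun i g => g + 2 ^ i * covered H d i g) 0.

(** Position d of the output is the place <j, n> of a unique pair, and the
    guess for n made at stage d is printed there.  Component j thus uses a
    different stage for each n, but the stages tend to infinity with j. *)
Definition answer (d H : nat) : bool :=
  has (fun n => has (fun j =>
     (cantor_pair j n == d) && covered H d n (guesses H d n)) (iota 0 d.+1))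
   (iota 0 d.+1).

Lemma definable_digit T (G : seq (T -> nat)) f g h :
  definable G f -> definable G g -> definable G h ->
  definable G (fun x => digit (f x) (g x) (h x)).
Proof. by rewrite /digit; auto 20 with definable. Qed.
#[export] Hint Resolve definable_digit : definable.

Lemma definable_track T (G : seq (T -> nat)) q f g :
  definable G f -> definable G g ->
  definable G (fun x => track q (f x) (g x)).
Proof. by rewrite /track; auto 20 with definable. Qed.
#[export] Hint Resolve definable_track : definable.

Lemma definable_run T (G : seq (T -> nat)) q f g :
  definable G f -> definable G g ->
  definable G (fun x => run q (f x) (g x)).
Proof. by rewrite /run; auto 20 with definable. Qed.
#[export] Hint Resolve definable_run : definable.

Lemma definable_emitted T (G : seq (T -> nat)) q f g h :
  definable G f -> definable G g -> definable G h ->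
  definable G (fun x => emitted q (f x) (g x) (h x) : nat).
Proof. by rewrite /emitted; auto 20 with definable. Qed.
#[export] Hint Resolve definable_emitted : definable.

Lemma definable_prefix_code T (G : seq (T -> nat)) f g :
  definable G f -> definable G g ->
  definable G (fun x => prefix_code (f x) (g x)).
Proof. by rewrite /prefix_code; auto 20 with definable. Qed.
#[export] Hint Resolve definable_prefix_code : definable.

Lemma definable_outside T (G : seq (T -> nat)) f g h :
  definable G f -> definable G g -> definable G h ->
  definable G (fun x => outside (f x) (g x) (h x) : nat).
Proof. by rewrite /outside; auto 20 with definable. Qed.
#[export] Hint Resolve definable_outside : definable.

Lemma definable_inside T (G : seq (T -> nat)) f g h k :
  definable G f -> definable G g -> definable G h -> definable G k ->
  definable G (fun x => inside (f x) (g x) (h x) (k x) : nat).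
Proof. by rewrite /inside; auto 20 with definable. Qed.
#[export] Hint Resolve definable_inside : definable.

Lemma definable_covered T (G : seq (T -> nat)) f g h k :
  definable G f -> definable G g -> definable G h -> definable G k ->
  definable G (fun x => covered (f x) (g x) (h x) (k x) : nat).
Proof. by rewrite /covered; auto 20 with definable. Qed.
#[export] Hint Resolve definable_covered : definable.

Lemma definable_guesses T (G : seq (T -> nat)) f g h :
  definable G f -> definable G g -> definable G h ->
  definable G (fun x => guesses (f x) (g x) (h x)).
Proof. by rewrite /guesses; auto 20 with definable. Qed.
#[export] Hint Resolve definable_guesses : definable.

Lemma definable_answer :
  definable [:: fst; snd] (fun s => answer s.1 s.2 : nat).
Proof. by rewrite /answer /cantor_pair; auto 20 with definable. Qed.

(** * Printing the values of a function stage by stage *)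

Section StagewiseProgram.
Variable v : nat -> nat.

Lemma exec_emit_ones x r t o :
  exec v (while x [:: Emit true]) (Store r t o)
    (Store (upd r x 0) t (o ++ nseq (r x) true)).
Proof.
move E: (r x) => k; elim: k r E o => [|k IH] r' E o.
  rewrite cats0; suff -> : upd r' x 0 = r' by exact: exec_while0.
  by apply/funext => y; rewrite /upd; case: eqP => // ->.
apply: exec_whileS; first by rewrite E.
  by apply: exec_instr => pc.
rewrite E /= -cat_rcons.
have -> : upd r' x 0 = upd (upd r' x k) x 0.
  by apply/funext => y; rewrite /upd; case: eqP.
by apply: IH; rewrite upd_eq.
Qed.

Lemma exec_incs x k r t o :
  exec v (nseq k (Inc x)) (Store r t o) (Store (upd r x (r x + k)) t o).
Proof.
elim: k r => [|k IH] r /=.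
  suff -> : upd r x (r x + 0) = r by exact: exec_nil.
  by apply/funext => y; rewrite /upd; case: eqP => // ->; rewrite addn0.
apply: (@exec_cons _ _ _ _ (Store (upd r x (r x).+1) t o)) => //.
suff -> : upd r x (r x + k.+1) = upd (upd r x (r x).+1) x
    (upd r x (r x).+1 x + k) by [].
by apply/funext => y; rewrite /upd eqxx addSnnS; case: eqP.
Qed.

Lemma exec_tick x r t o : v t <= 8 ->
  exec v (Tick :: nseq 8 (Inc x)) (Store r t o)
    (Store (upd r x (r x + v t)) t.+1 o).
Proof.
move=> v8 prog pc l.
have [_ l1] := loaded_cat (l : loaded _ _ ([:: Tick] ++ _)).
rewrite -{1}(subnK v8) nseqD in l1; have [_ {}l1] := loaded_cat l1.
apply: reaches_trans (_ : reaches v (inord (pc + 1 + (8 - v t)), Store r t.+1 o) _).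
  exists 1; rewrite /= (loaded_step _ _ l) /=; congr (inord _, _); lia.
have := @exec_incs x (v t) r t.+1 o _ _ l1.
by rewrite !size_nseq /=; congr (reaches _ _ (inord _, _)); lia.
Qed.

End StagewiseProgram.

(** Registers 0 and 1 hold the stage and the history and register 2 receives
    the value of the tick. *)
Lemma stagewise_program (F : nat -> nat -> nat) :
  definable [:: fst; snd] (fun s : nat * nat => F s.1 s.2) ->
  exists prog, forall v, (forall t, v t <= 8) -> forall n, exists rho,
    @reaches v prog (ord0, Store (fun=> 0) 0 [::])
      (ord0, Store rho n (unary (fun i => F i (encode 9 (mkseq v i))) n)).
Proof.
move=> dF.
have [//|//| cF HF] := dF [:: 0; 1] 2.
have [|//|//| cH HH] :=
    (_ : definable [:: (fun y : nat * nat * nat => y.1.1); (fun y => y.1.2); snd]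
           (fun y => y.1.2 + y.2 * 9 ^ y.1.1)) [:: 0; 1; 2] 3.
  by auto 20 with definable.
(* The loop that prints register 2 in unary counts it down to zero, and so the
   tick can deliver its value there. *)
pose emit := cF ++ while 2 [:: Emit true] ++ [:: Emit false].
pose update := (Tick :: nseq 8 (Inc 2)) ++
  cH ++ clear 1 ++ pour 3 1 ++ [:: Inc 0].
pose body := emit ++ update.
exists (body ++ [:: Back (size body)]) => v v8.
set q := fun i => F i _.
suff loop n : exists rho, [/\ rho 0 = n, rho 1 = encode 9 (mkseq v n) &
    @reaches v (body ++ [:: Back (size body)])
      (ord0, Store (fun=> 0) 0 [::]) (ord0, Store rho n (unary q n))].
  by move=> n; have [rho [_ _ H]] := loop n; exists rho.
elim: n => [|n [rho [r0 r1 H]]].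
  by exists (fun=> 0); split => //; exact: reaches_refl.
have [|rF [eF EF JF]] := HF (n, encode 9 (mkseq v n)) rho.
  by rewrite /= r0 r1.
pose ra := upd (upd rF 2 0) 2 (v n).
have [|rH [eH EH JH]] := HH (n, encode 9 (mkseq v n), v n) ra.
  by rewrite /= /ra upd_eq !upd_neq // !JF // r0 r1.
pose re := upd (upd (upd rH 1 0) 1 (rH 3)) 3 0.
exists (upd re 0 n.+1); split.
- by rewrite upd_eq.
- rewrite upd_neq // /re upd_neq // upd_eq EH.
  by rewrite mkseqS encode_rcons size_mkseq.
apply: reaches_trans H _.
have emitE : exec v emit (Store rho n (unary q n))
    (Store (upd rF 2 0) n (unary q n.+1)).
  apply: exec_cat (eF v _ _) _; apply: exec_cat (@exec_emit_ones v _ _ _ _) _.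
  apply: exec_instr => pc; congr (_, Store _ _ _).
  by rewrite EF /= /unary mkseqS flatten_rcons -rcons_cat.
have updE o : exec v update (Store (upd rF 2 0) n o) (Store (upd re 0 n.+1) n.+1 o).
  apply: exec_cat (@exec_tick v _ _ _ _ (v8 n)) _; rewrite upd_eq add0n -/ra.
  apply: exec_cat (eH v _ _) _.
  apply: exec_cat (@calc_clear _ _ v _ _) _.
  apply: exec_cat (@calc_pour 3 1 _ isT v _ _) _.
  apply: exec_instr => pc /=; congr (_, Store (upd _ _ _) _ _).
  - by rewrite upd_eq addn0 (upd_neq _ _ (isT : 3 != 1)).
  - by rewrite !upd_neq // JH // /ra !upd_neq // JF // r0.
have lall : loaded (body ++ [:: Back (size body)]) 0 (body ++ [:: Back (size body)]).
  by split.
have [lb lk] := loaded_cat lall.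
have := exec_cat emitE (updE _) lb; rewrite -/body.
rewrite (_ : inord 0 = ord0); last by apply: val_inj; rewrite /= inordK.
move=> H; apply: reaches_trans H _.
exists 1; rewrite /= (loaded_step _ _ lk) /= add0n subnn.
by congr (_, _); apply: val_inj; rewrite /= inordK.
Qed.

(** * Counter programs on multi-tape machines *)

Lemma input_cell_zero k : input_cell (fun=> 0) k = false.
Proof.
rewrite /input_cell; have -> n : unary (fun=> 0) n = nseq n false.
  elim: n => // n IH; rewrite /unary mkseqS flatten_rcons -/(unary _ n) IH /=.
  by rewrite cats1 -[RHS]/(nseq n.+1 false) -addn1 nseqD cats1.
by rewrite nth_nseq if_same.
Qed.

Definition option_code (o : option bool) : nat :=
  if o is Some b then b.+1 else 0.

Section Simulation.
Variables (E : machine) (prog : seq instr).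

(** The machine E is run on the zero input, without looking at the input
    tape of the host. *)
Definition guest (t : nat) : config E := iter t (step (fun=> 0)) (init E).

Definition emission (t : nat) : option bool :=
  let c := guest t in
  (transition (cur_state c) false [ffun k => work_cell c k (work_head c k)]).2.

Definition tick_value (p : baire) (t : nat) : nat :=
  encode 3 [:: option_code (Some (input_cell p t)); option_code (emission t)].

Lemma tick_value_le8 p t : tick_value p t <= 8.
Proof.
by rewrite /tick_value /=; case: (input_cell p t); case: (emission t) => [[]|].
Qed.

Definition instr_reg (i : instr) : nat :=
  match i with Inc x => x | Dec x _ => x | _ => 0 end.

Definition max_reg : nat := \max_(i <- prog) instr_reg i.

Lemma instr_reg_le pc : instr_reg (fetch prog pc) <= max_reg.
Proof.
have [lt_pc|ge_pc] := ltnP pc (size prog); last by rewrite /fetch nth_default.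
rewrite /max_reg (big_nth (Back 0)) big_mkord.
exact: (leq_bigmax_cond (Ordinal lt_pc)).
Qed.

Definition host_tape : finType := ('I_max_reg.+1 + tape E)%type.
Definition host_symbol : finType := (symbol E * bool)%type.
Definition host_state : finType := (option 'I_(size prog).+1 * state E)%type.

(** A tape of the host with index inl i represents register i by the
    position of its head.  Cell 0 of these tapes carries a mark, written in
    the first step, that makes it possible to test for zero.  The other
    tapes are those of E. *)
Definition host_transition (q : host_state) (b : bool)
    (cells : {ffun host_tape -> host_symbol}) :
    host_state * move * {ffun host_tape -> host_symbol * move} * option bool :=
  let idle := [ffun k => (cells k, Stay)] in
  let goto (n : nat) : host_state := (Some (inord n), q.2) in
  if q.1 is Some pc then
    match fetch prog pc with
    | Inc x => (goto pc.+1, Stay,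
        [ffun k => (cells k, if k == inl (inord x) then Right else Stay)], None)
    | Dec x j =>
        if (cells (inl (inord x))).2 then (goto (pc + j), Stay, idle, None)
        else (goto pc.+1, Stay,
          [ffun k => (cells k, if k == inl (inord x) then Left else Stay)], None)
    | Back j => (goto (pc - j), Stay, idle, None)
    | Emit b' => (goto pc.+1, Stay, idle, Some b')
    | Tick =>
        let: (u, _, w, o) :=
          transition q.2 false [ffun k => (cells (inr k)).1] in
        let n := encode 3 [:: option_code (Some b); option_code o] in
        ((Some (inord (pc + (9 - n))), u), Right,
         [ffun k => match k with
                    | inl _ => (cells k, Stay)
                    | inr k' => ((w k').1, (cells k).2, (w k').2)
                    end], None)
    end
  else ((Some ord0, q.2), Stay,
    [ffun k => ((cells k).1, true, Stay)], None).

Definition host : machine :=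
  @Machine host_state host_symbol host_tape (None, start E) (blank E, false)
    host_transition.

Record simulates (s : 'I_(size prog).+1 * store) (c : config host) : Prop :=
  Simulates {
  sim_state : cur_state c = (Some s.1, cur_state (guest (time s.2)));
  sim_input : input_head c = time s.2;
  sim_reg : forall i : 'I_max_reg.+1, work_head c (inl i) = Posz (reg s.2 i);
  sim_mark : forall (i : 'I_max_reg.+1) (z : nat),
    (work_cell c (inl i) (Posz z)).2 = (z == 0);
  sim_head : forall k, work_head c (inr k) = work_head (guest (time s.2)) k;
  sim_cell : forall k z,
    (work_cell c (inr k) z).1 = work_cell (guest (time s.2)) k z;
  sim_out : output c = out s.2 }.

Lemma simulates_init p :
  simulates (ord0, Store (fun=> 0) 0 [::]) (step p (init host)).
Proof.
split=> //=.
- by move=> i; rewrite ffunE.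
- by move=> i z; rewrite !ffunE /=; case: z.
- by move=> k; rewrite ffunE.
- by move=> k z; rewrite !ffunE /=; case: ifP.
Qed.

Lemma host_reg (i : 'I_max_reg.+1) x : x <= max_reg ->
  (i == inord x) = (i == x :> nat).
Proof. by move=> le_x; rewrite -val_eqE /= inordK. Qed.

Lemma simulates_step p s c : simulates s c ->
  simulates (run_step (tick_value p) s) (step p c).
Proof.
case: s => pc [rho t o] [/= Es Ei Er Em Eh Ec Eo].
rewrite /run_step /step /= Es Ei /=.
set cells := [ffun k => _].
have cE k : cells k = work_cell c k (work_head c k) by rewrite ffunE.
rewrite /host_transition /=.
have := instr_reg_le pc; case: (fetch prog pc) => [x|x j|j|b|] /= le_x.
- split => //=.
  + move=> i; rewrite ffunE /= (inj_eq (@inl_inj _ _)) Er /upd (host_reg i le_x).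
    by case: eqP => [->|] //=; lia.
  + by move=> i z; rewrite ffunE /= -(Em i z); case: eqP => [->|]; rewrite ?cE.
  + by move=> k; rewrite ffunE /= Eh.
  + by move=> k z; rewrite ffunE /= -(Ec k z); case: eqP => [->|]; rewrite ?cE.
- rewrite cE Er Em inordK //; case: eqP => x0.
    split => //=.
    + by move=> i; rewrite ffunE /= Er.
    + by move=> i z; rewrite ffunE /= -(Em i z); case: eqP => [->|]; rewrite ?cE.
    + by move=> k; rewrite ffunE /= Eh.
    + by move=> k z; rewrite ffunE /= -(Ec k z); case: eqP => [->|]; rewrite ?cE.
  split => //=.
  + move=> i; rewrite ffunE /= (inj_eq (@inl_inj _ _)) Er /upd (host_reg i le_x).
    by case: eqP => [->|] //=; rewrite ?inordK //; lia.
  + by move=> i z; rewrite ffunE /= -(Em i z); case: eqP => [->|]; rewrite ?cE.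
  + by move=> k; rewrite ffunE /= Eh.
  + by move=> k z; rewrite ffunE /= -(Ec k z); case: eqP => [->|]; rewrite ?cE.
- split => //=.
  + by move=> i; rewrite ffunE /= Er.
  + by move=> i z; rewrite ffunE /= -(Em i z); case: eqP => [->|]; rewrite ?cE.
  + by move=> k; rewrite ffunE /= Eh.
  + by move=> k z; rewrite ffunE /= -(Ec k z); case: eqP => [->|]; rewrite ?cE.
- split => //=; last by rewrite Eo.
  + by move=> i; rewrite ffunE /= Er.
  + by move=> i z; rewrite ffunE /= -(Em i z); case: eqP => [->|]; rewrite ?cE.
  + by move=> k; rewrite ffunE /= Eh.
  + by move=> k z; rewrite ffunE /= -(Ec k z); case: eqP => [->|]; rewrite ?cE.
have cells_guest : [ffun k => (cells (inr k)).1] =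
    [ffun k => work_cell (guest t) k (work_head (guest t) k)].
  by apply/ffunP => k; rewrite !ffunE Eh Ec.
rewrite cells_guest /tick_value /emission.
move: (erefl (step (fun=> 0) (guest t))); rewrite {2}/step input_cell_zero.
case: transition => [[[u m] w] o'] guestS.
split => //=; rewrite ?guestS //=.
- by move=> i; rewrite ffunE /= Er.
- by move=> i z; rewrite ffunE /= -(Em i z); case: eqP => [->|]; rewrite ?cE.
- by move=> k; rewrite ffunE /= Eh.
- by move=> k z; rewrite ffunE /= Eh -(Ec k z); case: eqP.
Qed.

Lemma host_reaches p s s' : reaches (tick_value p) s s' ->
  forall c, simulates s c ->
  exists k, simulates s' (iter k (step p) c).
Proof.
move=> [k <-]; elim: k => [|k IH] c sc; first by exists 0.
have [l H] := IH _ sc; exists l.+1; exact: simulates_step.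
Qed.

End Simulation.

Lemma writes_stagewise (E : machine) (F : nat -> nat -> nat) :
  definable [:: fst; snd] (fun s : nat * nat => F s.1 s.2) ->
  exists M, forall p,
    writes M p (fun i => F i (encode 9 (mkseq (tick_value E p) i))).
Proof.
move=> /stagewise_program[prog H]; exists (host E prog) => p n.
have [rho /host_reaches H'] := H _ (tick_value_le8 E p) n.
have [k sk] := H' _ (simulates_init E prog p).
exists k.+1; rewrite iterSr (sim_out sk); exact: prefix_refl.
Qed.

(** * Low basis theorem for converging guesses *)

Section LowBasis.

(** If no level bars all paths, extend a word bit by bit, keeping the
    property that at every level some unbarred path extends it.  The
    resulting path is never barred. *)
Lemma fan_theorem (C : nat -> (nat -> bool) -> Prop) :
  (forall d d' a, d <= d' -> C d a -> C d' a) ->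
  (forall d a b, (forall i, i < d -> a i = b i) -> C d a -> C d b) ->
  (forall a, exists d, C d a) -> exists d, forall a, C d a.
Proof.
move=> mono loc cover; apply: contrapT => /forallNP nC.
pose ext w := forall d, exists a, mkseq a (size w) = w /\ ~ C d a.
have extS w : ext w -> ~ ext (rcons w true) -> ext (rcons w false).
  move=> ew /existsNP[d1 /forallNP n1] d2.
  have [a [aw nCa]] := ew (maxn d1 d2).
  have nCd d : d <= maxn d1 d2 -> ~ C d a by move=> le_d /(mono _ _ _ le_d).
  have aS : mkseq a (size w).+1 = rcons w (a (size w)) by rewrite mkseqS aw.
  case E : (a (size w)) aS => aS.
    case: (n1 a); split; first by rewrite size_rcons.
    by apply: nCd; exact: leq_maxl.
  exists a; split; first by rewrite size_rcons.
  by apply: nCd; exact: leq_maxr.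
pose next w := rcons w `[< ext (rcons w true) >].
pose path n := iter n next [::].
have size_path n : size (path n) = n by elim: n => //= n; rewrite size_rcons => ->.
have ext_path n : ext (path n).
  elim: n => [|n IH] /=.
    by move=> d; have /existsNP[a na] := nC d; exists a.
  by rewrite /next; case: asboolP => // /(extS _ IH).
pose a n := nth true (path n.+1) n.
have aE n : mkseq a n = path n.
  elim: n => // n IH; rewrite mkseqS IH /a /= /next; congr rcons.
  by rewrite nth_rcons size_path ltnn eqxx.
have [d Cda] := cover a; have [b [bE]] := ext_path d d; apply.
apply: loc Cda => i lt_i; rewrite -(nth_mkseq true a lt_i) -(nth_mkseq true b lt_i).
by rewrite aE -bE size_path.
Qed.

Variables (P : nat -> (nat -> bool) -> Prop).
Variables (V : nat -> nat -> (nat -> bool) -> Prop).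
Variable g : nat -> nat -> bool.
Hypothesis P_mono : forall d d' a, d <= d' -> P d a -> P d' a.
Hypothesis V_mono : forall d d' n a, d <= d' -> V d n a -> V d' n a.
Hypothesis P_local : forall d a b, (forall i, i < d -> a i = b i) -> P d a -> P d b.
Hypothesis V_local :
  forall d n a b, (forall i, i < d -> a i = b i) -> V d n a -> V d n b.
Hypothesis gP : forall d n, g d n <->
  forall a, P d a \/ exists m, [/\ m <= n, m = n \/ ~~ g d m & V d m a].

(** By induction on n: once the guesses for all m < n are final, the
    condition in gP that makes the guess for n true persists, because P and
    V only grow. *)
Lemma guesses_stabilize : exists h : nat -> bool,
  forall n, exists D, forall m d, m < n -> D <= d -> g d m = h m.
Proof.
have stable n : exists D, forall m d, m < n -> D <= d -> g d m = g D m.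
  elim: n => [|n [D HD]]; first by exists 0.
  have [[d0 [le_d0 gd0]]|no] := pselect (exists d, D <= d /\ g d n).
    have E m d : m < n -> d0 <= d -> g d m = g d0 m.
      by move=> lt_m le_d; rewrite !HD //; lia.
    exists d0 => m d; rewrite ltnS leq_eqVlt => /predU1P[-> le_d|]; last exact: E.
    rewrite gd0; apply/gP => a; have /gP/(_ a) := gd0.
    case=> [/(P_mono le_d)|[m' [le_m' H' /(V_mono le_d) Vm]]]; first by left.
    right; exists m'; split => //; case: H' => [|ng]; first by left.
    have [->|ne] := eqVneq m' n; first by left.
    by right; rewrite E //; lia.
  have F d : D <= d -> g d n = false.
    by move=> le_d; apply/negP => gd; apply: no; exists d.
  exists D => m d; rewrite ltnS leq_eqVlt => /predU1P[-> le_d|]; last exact: HD.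
  by rewrite !F.
have [D HD] := choice (fun n => stable n.+1).
exists (fun n => g (D n) n) => n; exists (\max_(m < n) D m) => m d lt_m le_d.
apply: HD => //; apply: leq_trans le_d.
exact: (leq_bigmax (Ordinal lt_m)).
Qed.

(** P d a and V d n a say that by stage d the path a is seen to lie outside
    the closed set and in the n-th open set.  For the limit h of the
    guesses, no stage bars all paths by P and the V n with h n false: the
    last of the finitely many n involved would have been guessed true.  By
    the fan theorem a path avoids them all. *)
Lemma low_basis : (exists a, forall d, ~ P d a) ->
  exists (h : nat -> bool) a,
    [/\ forall n, exists D, forall d, D <= d -> g d n = h n,
        forall d, ~ P d a & forall n, h n <-> exists d, V d n a].
Proof.
move=> [a0 Pa0]; have [h hP] := guesses_stabilize; exists h.
pose C d a := P d a \/ exists m, [/\ m < d, ~~ h m & V d m a].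
(* If V N is to be avoided and level d bars all paths by P and the V m up to N,
   then this is the condition under which the guess for N is true. *)
have nofan N : ~ exists d, forall a, P d a \/ exists m, [/\ m < N, ~~ h m & V d m a].
  elim: N => [|N IH] [d Hd]; first by have [/Pa0|[m []]] := Hd a0.
  case hN : (h N).
    apply: IH; exists d => a; have [|[m [lt_m hm Vm]]] := Hd a; first by left.
    right; exists m; split => //; rewrite ltn_neqAle -ltnS lt_m andbT.
    by apply/eqP => mN; rewrite mN hN in hm.
  have [D HD] := hP N.+1; have := HD N (maxn d D) (ltnSn _) (leq_maxr _ _).
  rewrite hN => /negP; apply; apply/gP => a.
  have [/(P_mono (leq_maxl _ D))|[m [lt_m hm Vm]]] := Hd a; first by left.
  right; exists m; split => //; last exact: V_mono (leq_maxl _ _) Vm.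
  by right; rewrite HD ?leq_maxr.
have [a Ca] : exists a, forall d, ~ C d a.
  apply: contrapT => /forallNP nC.
  have [| |a|d Cd] := @fan_theorem C.
  - move=> d d' a le_d [/(P_mono le_d)|[m [lt_m hm /(V_mono le_d) Vm]]].
      by left.
    by right; exists m; split => //; lia.
  - move=> d a b ab [/(P_local ab)|[m [lt_m hm /(V_local ab) Vm]]]; first by left.
    by right; exists m.
  - by have /existsNP[d /contrapT] := nC a; exists d.
  - by apply: (nofan d); exists d.
exists a; split => [n|d Pd|n].
- by have [D HD] := hP n.+1; exists D => d le_d; apply: HD.
- by apply: (Ca d); left.
split => [hn|[d Vd]].
  have [D HD] := hP n.+1; pose d := maxn D n.+1.
  have gdE m : m <= n -> g d m = h m by move=> le_m; rewrite HD // leq_maxl.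
  (* A late true guess puts every path into V n that P and the avoided V m do
     not bar, and a is such a path. *)
  have := hn; rewrite -gdE // => /gP/(_ a)[Pd|[m [le_m [->|gm] Vm]]].
  - by case: (Ca d); left.
  - by exists d.
  - case: (Ca d); right; exists m; split => //; last by rewrite -gdE.
    by rewrite /d; lia.
apply: contrapT => /negP hn; apply: (Ca (maxn d n.+1)); right; exists n.
by split => //; [exact: leq_maxr | exact: V_mono (leq_maxl _ _) Vd].
Qed.

End LowBasis.

(** * Sequences written in unary on a tape *)

(** The values completed in the list l of bits, if r ones came before l. *)
Fixpoint unary_values (r : nat) (l : seq bool) : seq nat :=
  if l is b :: l' then
    if b then unary_values r.+1 l' else r :: unary_values 0 l'
  else [::].

Definition last_run (r : nat) (l : seq bool) : nat :=
  foldl (fun r b => if b then r.+1 else 0) r l.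

Lemma unary_values_cat r l1 l2 :
  unary_values r (l1 ++ l2) =
    unary_values r l1 ++ unary_values (last_run r l1) l2.
Proof. by elim: l1 r => //= -[] l1 IH r; rewrite IH. Qed.

Lemma unary_values_prefix l1 l2 :
  prefix l1 l2 -> prefix (unary_values 0 l1) (unary_values 0 l2).
Proof. by move=> /prefixP[l ->]; rewrite unary_values_cat prefix_prefix. Qed.

Lemma unary_flatten p n :
  unary p n = flatten (map (fun k => rcons (nseq k true) false) (mkseq p n)).
Proof. by rewrite /unary /mkseq -map_comp. Qed.

Lemma unary_values_unary p n : unary_values 0 (unary p n) = mkseq p n.
Proof.
rewrite unary_flatten; elim: (mkseq p n) => //= k s IH.
have H l r :
    unary_values r (rcons (nseq k true) false ++ l) = r + k :: unary_values 0 l.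
  by elim: k r => [|k IHk] r /=; rewrite ?addn0 // IHk addSnnS.
by rewrite H IH.
Qed.

Lemma prefix_unary p n m : n <= m -> prefix (unary p n) (unary p m).
Proof.
move=> /subnKC <-; elim: (m - n) => [|k IH]; first by rewrite addn0 prefix_refl.
apply: prefix_trans IH _.
by rewrite addnS /unary mkseqS flatten_rcons prefix_prefix.
Qed.

Lemma size_unary p n : n <= size (unary p n).
Proof.
elim: n => // n IH; rewrite /unary mkseqS flatten_rcons size_cat size_rcons.
by rewrite -/(unary p n); lia.
Qed.

Lemma prefix_nth (l1 l2 : seq bool) k : prefix l1 l2 -> k < size l1 ->
  nth false l1 k = nth false l2 k.
Proof. by move=> /prefixP[l ->] lt_k; rewrite nth_cat lt_k. Qed.

Lemma prefix_total (l1 l2 l : seq bool) : prefix l1 l -> prefix l2 l ->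
  size l1 <= size l2 -> prefix l1 l2.
Proof.
rewrite !prefixE => /eqP E1 /eqP E2 le12.
by rewrite -E2 take_takel // E1.
Qed.

(** A stream of optional bits, as a machine delivers them: not every step
    writes. *)
Definition emitted_bits (o : nat -> option bool) (d : nat) : seq bool :=
  pmap id (mkseq o d).

Lemma emitted_bitsS o d : emitted_bits o d.+1 =
  if o d is Some b then rcons (emitted_bits o d) b else emitted_bits o d.
Proof.
rewrite /emitted_bits mkseqS -cats1 pmap_cat /=.
by case: (o d) => [b|] /=; rewrite ?cats1 ?cats0.
Qed.

Lemma prefix_emitted_bits o d d' : d <= d' ->
  prefix (emitted_bits o d) (emitted_bits o d').
Proof.
move=> /subnKC <-; elim: (d' - d) => [|k IH]; first by rewrite addn0 prefix_refl.
apply: prefix_trans IH _; rewrite addnS emitted_bitsS.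
by case: (o _) => [b|]; rewrite ?prefix_rcons ?prefix_refl.
Qed.

Lemma last_run_rcons l b :
  last_run 0 (rcons l b) = if b then (last_run 0 l).+1 else 0.
Proof. by rewrite /last_run -cats1 foldl_cat. Qed.

Lemma unary_values_rcons l b :
  unary_values 0 (rcons l b) =
    if b then unary_values 0 l else rcons (unary_values 0 l) (last_run 0 l).
Proof. by rewrite -cats1 unary_values_cat; case: b => /=; rewrite ?cats0 ?cats1. Qed.

Lemma run_track q H o d : (forall k, k < d -> track q H k = option_code (o k)) ->
  run q H d = last_run 0 (emitted_bits o d).
Proof.
elim: d => // d IH Ho; rewrite emitted_bitsS /run /= -/(run q H d) Ho // IH.
  by case: (o d) => [[]|] //=; rewrite last_run_rcons.
by move=> k lt_k; apply: Ho; lia.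
Qed.

Lemma emitted_track q H o d v :
  (forall k, k < d -> track q H k = option_code (o k)) ->
  emitted q H d v = (v \in unary_values 0 (emitted_bits o d)).
Proof.
elim: d => // d IH Ho.
have Ho' k : k < d -> track q H k = option_code (o k) by move=> lt_k; apply: Ho; lia.
rewrite /emitted iotaSr has_rcons -/(emitted q H d v) IH // emitted_bitsS.
rewrite (run_track Ho') Ho //.
case: (o d) => [[]|] //=; rewrite unary_values_rcons //.
by rewrite mem_rcons inE eq_sym.
Qed.

(** The second clause makes sure that the stream produces nothing but the
    unary notation of q. *)
Definition spells (o : nat -> option bool) (q : baire) : Prop :=
  (forall n, exists d, prefix (unary q n) (emitted_bits o d)) /\
  (forall d, exists n, prefix (emitted_bits o d) (unary q n)).

Lemma spells_range o q v : spells o q ->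
  (exists d, v \in unary_values 0 (emitted_bits o d)) <-> exists i, q i = v.
Proof.
move=> [oq qo]; split => [[d]|[i <-]].
  have [n /unary_values_prefix/prefixP[s E]] := qo d.
  move=> vd; have : v \in mkseq q n by rewrite -unary_values_unary E mem_cat vd.
  by case/mapP => i _ ->; exists i.
have [d /unary_values_prefix] := oq i.+1.
rewrite unary_values_unary => /prefixP[s E].
by exists d; rewrite E mem_cat map_f // mem_iota ltnSn.
Qed.

Lemma emitted_bits_Some c d : emitted_bits (fun t => Some (c t)) d = mkseq c d.
Proof. by elim: d => // d IH; rewrite emitted_bitsS IH mkseqS. Qed.

Lemma input_cell_nth p n k : k < size (unary p n) ->
  input_cell p k = nth false (unary p n) k.
Proof.
rewrite /input_cell => lt_k.
case: (leqP n k.+1) => [/(prefix_unary p)/prefix_nth -> //|/ltnW/(prefix_unary p)].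
by move=> /prefix_nth ->; last exact: size_unary.
Qed.

Lemma spells_input p : spells (fun t => Some (input_cell p t)) p.
Proof.
split => n; rewrite ?emitted_bits_Some.
  exists (size (unary p n)); rewrite emitted_bits_Some.
  suff -> : mkseq (input_cell p) (size (unary p n)) = unary p n.
    exact: prefix_refl.
  apply: (@eq_from_nth _ false); rewrite size_mkseq // => k lt_k.
  by rewrite nth_mkseq //; exact: input_cell_nth.
exists n; rewrite prefixE size_mkseq; apply/eqP.
apply: (@eq_from_nth _ false);
  rewrite ?size_mkseq size_takel ?size_unary // => k lt_k.
rewrite nth_take // nth_mkseq // (@input_cell_nth _ n) //.
exact: leq_trans lt_k (size_unary _ _).
Qed.

Lemma output_guest E t : output (guest E t) = emitted_bits (emission E) t.
Proof.
elim: t => // t IH; rewrite emitted_bitsS -IH /emission /= /step input_cell_zero.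
by case: transition => [[[u m] w] [b|]].
Qed.

(** An output bit list and the notation of a long enough initial part of q
    are both initial segments of a later output, hence comparable. *)
Lemma spells_guest E q : writes E (fun=> 0) q -> spells (emission E) q.
Proof.
move=> wq; have H n : exists d, prefix (unary q n) (emitted_bits (emission E) d).
  by have [t] := wq n; rewrite -/(guest E t) output_guest; exists t.
split=> // d; set l := emitted_bits _ d; exists (size l).
have [d' Hd'] := H (size l).
apply: (@prefix_total _ _ (emitted_bits (emission E) (maxn d d'))).
- by apply: prefix_emitted_bits; exact: leq_maxl.
- by apply: prefix_trans Hd' _; apply: prefix_emitted_bits; exact: leq_maxr.
- exact: size_unary.
Qed.

(** * Words, cylinders and pairs *)

Definition bits (x i : nat) : bool := digit 2 x i == 1.

Lemma prefix_codeE x j :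
  prefix_code x j = CodeSeq.code (map nat_of_bool (mkseq (bits x) j)).
Proof.
suff H i : i <= j -> iteri i
    (fun i c => 2 ^ digit 2 x (j.-1 - i) * (2 * c + 1)) 0 =
    CodeSeq.code (drop (j - i) (map nat_of_bool (mkseq (bits x) j))).
  by rewrite /prefix_code H // subnn drop0.
elim: i => [|i IH] lt_i.
  by rewrite subn0 drop_oversize // size_map size_mkseq.
rewrite /= {}IH; last by lia.
have -> : j.-1 - i = j - i.+1 by lia.
rewrite [drop (j - i.+1) _](drop_nth 0); last by rewrite size_map size_mkseq; lia.
rewrite (_ : (j - i.+1).+1 = j - i); last by lia.
rewrite (nth_map false); last by rewrite size_mkseq; lia.
rewrite nth_mkseq /=; last by lia.
congr (2 ^ _ * _); last by lia.
rewrite /bits; have : digit 2 x (j - i.+1) < 2 by exact: ltn_pmod.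
by case: digit => [|[|]].
Qed.

(** A property of the first d bits holds for all paths if it holds for the
    finitely many paths given by the binary digits of the numbers below 2^d. *)
Lemma all_words (Q : (nat -> bool) -> bool) d :
  (forall a b, (forall i, i < d -> a i = b i) -> Q a -> Q b) ->
  all (fun x => Q (bits x)) (iota 0 (2 ^ d)) <-> forall a, Q a.
Proof.
move=> loc; split => [/allP H a|H]; last by apply/allP => x _; exact: H.
pose s := map nat_of_bool (mkseq a d).
have s2 : all (fun v => v < 2) s by apply/allP => _ /mapP[b _ ->]; case: b.
apply: loc (H (encode 2 s) _).
  move=> i lt_i; rewrite /bits digit_encode // (nth_map false) ?size_mkseq //.
  by rewrite nth_mkseq //; case: (a i).
by rewrite mem_iota /=; have := encode_lt s2; rewrite size_map size_mkseq.
Qed.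

(** The triangular numbers t s, s = j + n, increase by s + 1 > n at each
    step, so s can be recovered from t s + n. *)
Lemma cantor_pair_inj j n j' n' : cantor_pair j n = cantor_pair j' n' ->
  j = j' /\ n = n'.
Proof.
pose t s := (s * s.+1)./2.
have tS s : t s.+1 = t s + s.+1.
  rewrite /t; have -> : s.+1 * s.+2 = s * s.+1 + (s.+1).*2 by lia.
  by rewrite halfD doubleK odd_double andbF add0n.
have t_mono s s' : s <= s' -> t s <= t s'.
  by move=> /subnKC <-; elim: (s' - s) => [|k IH]; rewrite ?addn0 // addnS tS; lia.
rewrite /cantor_pair -/(t (j + n)) -/(t (j' + n')) => E.
have [lt|gt|] := ltngtP (j + n) (j' + n'); last by move=> ss; rewrite ss in E; lia.
- by have := t_mono _ _ lt; rewrite tS; lia.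
- by have := t_mono _ _ gt; rewrite tS; lia.
Qed.

Lemma leq_cantor_pair j n : j + n <= cantor_pair j n.
Proof.
rewrite /cantor_pair; have : j + n <= ((j + n) * (j + n).+1)./2; last by lia.
by elim: (j + n) => // s IH; nia.
Qed.

Lemma answer_pair j n (H : nat) :
  answer (cantor_pair j n) H =
  covered H (cantor_pair j n) n (guesses H (cantor_pair j n) n).
Proof.
have le := leq_cantor_pair j n; set d := cantor_pair j n.
apply/hasP/idP => [[n' _ /hasP[j' _ /andP[/eqP/cantor_pair_inj[_ ->]]]]//|C].
exists n; first by rewrite mem_iota /d; lia.
apply/hasP; exists j; first by rewrite mem_iota /d; lia.
by rewrite eqxx.
Qed.

Local Open Scope classical_set_scope.

(** By stage d the stream o has enumerated the code of one of the words of
    length at most d that are initial segments of a. *)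
Definition seen (o : nat -> option bool) (code : seq bool -> nat) (d : nat)
    (a : nat -> bool) : bool :=
  has (fun j => (code (mkseq a j)).+1 \in unary_values 0 (emitted_bits o d))
    (iota 0 d.+1).

Lemma seen_mono o code d d' a : d <= d' -> seen o code d a -> seen o code d' a.
Proof.
move=> le_d /hasP[j]; rewrite mem_iota => lt_j vj; apply/hasP; exists j.
  by rewrite mem_iota; lia.
have /unary_values_prefix/prefixP[s ->] := prefix_emitted_bits o le_d.
by rewrite mem_cat vj.
Qed.

Lemma seen_local o code d a b : (forall i, i < d -> a i = b i) ->
  seen o code d a -> seen o code d b.
Proof.
move=> ab /hasP[j jd]; rewrite (_ : mkseq a j = mkseq b j); last first.
  apply/eq_in_map => i; rewrite mem_iota => lt_i; apply: ab.
  by move: jd; rewrite mem_iota; lia.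
by move=> vj; apply/hasP; exists j.
Qed.

Lemma seen_ex o q code a : spells o q ->
  (exists d, seen o code d a) <-> exists j i, q i = (code (mkseq a j)).+1.
Proof.
move=> oq; split => [[d /hasP[j _ vj]]|[j /(spells_range _ oq)[d vj]]].
  by exists j; apply/(spells_range _ oq); exists d.
exists (maxn d j).
have /unary_values_prefix/prefixP[s E] := prefix_emitted_bits o (leq_maxl d j).
apply/hasP; exists j; first by rewrite mem_iota; lia.
by rewrite E mem_cat vj.
Qed.

Lemma enumerates_ex (T : Type) (code : T -> nat) q W w : injective code ->
  enumerates code q W -> (exists i, q i = (code w).+1) <-> W w.
Proof.
move=> inj E; split => [[i qi]|Ww].
  have : (range q `\ 0) (code w).+1 by split => //; exists i.
  by rewrite E => -[w' Ww' [/inj <-]].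
have : [set (code w).+1 | w in W] (code w).+1 by exists w.
by rewrite -E => -[[i _ qi] _]; exists i.
Qed.

Lemma indexed_word_code_inj : injective indexed_word_code.
Proof. by move=> [n w] [n' w'] /(can_inj CodeSeq.codeK) [-> ->]. Qed.

Lemma cylinder_mkseq (T : Type) (a : nat -> T) w :
  cylinder w a <-> exists j, mkseq a j = w.
Proof.
by split => [aw|[j <-]]; [exists (size w) | rewrite /cylinder /= size_mkseq].
Qed.

(** * The guesses computed from a name *)

Section Stages.
Variables (E : machine) (p : baire).

Definition history (d : nat) : nat := encode 9 (mkseq (tick_value E p) d).

Definition seen_outside : nat -> (nat -> bool) -> bool :=
  seen (fun t => Some (input_cell p t)) binary_word_code.

Definition seen_inside (d n : nat) : (nat -> bool) -> bool :=
  seen (emission E) (fun w => indexed_word_code (n, map nat_of_bool w)) d.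

Definition guess (d n : nat) : bool :=
  covered (history d) d n (guesses (history d) d n).

Lemma track_history q d k : k < d -> q < 2 -> track q (history d) k =
  nth 0 [:: option_code (Some (input_cell p k)); option_code (emission E k)] q.
Proof.
move=> lt_k q2; rewrite /track /history digit_encode; last first.
  by apply/allP => _ /mapP[t _ ->]; rewrite ltnS tick_value_le8.
rewrite nth_mkseq // digit_encode //=.
by case: (input_cell p k); case: (emission E k) => [[]|].
Qed.

Lemma outside_history d x : outside (history d) d x = seen_outside d (bits x).
Proof.
apply: eq_in_has => j _; rewrite prefix_codeE; apply: emitted_track => k lt_k.
exact: track_history.
Qed.

Lemma inside_history d n x :
  inside (history d) d n x = seen_inside d n (bits x).
Proof.
apply: eq_in_has => j _; rewrite prefix_codeE mul2n addn1.
by apply: emitted_track => k lt_k; exact: track_history.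
Qed.

Lemma guesses_history d n :
  guesses (history d) d n = encode 2 (mkseq (fun m => guess d m : nat) n).
Proof.
elim: n => // n IH; rewrite mkseqS encode_rcons size_mkseq -IH mulnC.
by rewrite {1}/guesses /= -/(guesses _ _ _).
Qed.

(** The bounded test on numbers is the unbounded statement of the hypothesis
    of low_basis, since at stage d only the first d bits of a path matter. *)
Lemma guessP d n : guess d n <-> forall a, seen_outside d a \/
  exists m, [/\ m <= n, m = n \/ ~~ guess d m & seen_inside d m a].
Proof.
pose Q a := seen_outside d a || has (fun m =>
  ((m == n) || ~~ guess d m) && seen_inside d m a) (iota 0 n.+1).
have -> : guess d n = all (fun x => Q (bits x)) (iota 0 (2 ^ d)).
  apply: eq_in_all => x _; rewrite outside_history; congr (_ || _).
  apply: eq_in_has => m; rewrite mem_iota => lt_m.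
  rewrite inside_history; case: eqP => //= ne; congr (_ && _).
  rewrite guesses_history digit_encode; last first.
    by apply/allP => _ /mapP[t _ ->]; case: (guess d t).
  by rewrite nth_mkseq ?eqb0 //; lia.
rewrite all_words /Q; last first.
  move=> a b ab /orP[Pa|/hasP[m m_n /andP[Hm Vm]]]; apply/orP.
    by left; exact: seen_local ab Pa.
  right; apply/hasP; exists m => //; rewrite Hm /=; exact: seen_local ab Vm.
split => H a.
  have /orP[->|/hasP[m + /andP[/orP Hm Vm]]] := H a; first by left.
  rewrite mem_iota => lt_m; right; exists m; split => //.
  by case: Hm => [/eqP|]; [left | right].
apply/orP; have [->|[m [le_m Hm Vm]]] := H a; first by left.
right; apply/hasP; exists m; first by rewrite mem_iota.
by rewrite Vm andbT; case: Hm => [->|->]; rewrite ?eqxx ?orbT.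
Qed.

End Stages.

(** Convergence in the product of discrete spaces is eventual constancy of
    each coordinate. *)
Lemma cvg_baire (f : nat -> baire) (q : baire) :
  (forall n, exists D, forall j, D <= j -> f j n = q n) -> f @ \oo --> q.
Proof.
move=> H; apply/cvg_sup => i; apply/cvg_image.
  by apply/seteqP; split => // b _; exists (fun=> b).
move=> V /=; rewrite nbhs_principalE => /principal_filterP Vqi.
exists [set z : baire | V (z i)]; last first.
  by apply/seteqP; split => [b [z ? <-] //|b Vb]; exists (fun=> b).
have [D HD] := H i; exists D => // j /= le_j.
by rewrite HD.
Qed.

Theorem theorem8p3 :
  forall U : nat -> set baire, standard_enumeration U ->
  low_computable U psi_minus cantor_representation closed_choice_cantor.
Proof.
move=> U [[W [e [E we] eW] UE] _].
have [M MP] := @writes_stagewise E (fun d H => answer d H) definable_answer.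
exists (writes M); first by exists M.
move=> p A [W' pW' AE] [a0 Aa0].
have outP a : (exists d, seen_outside p d a) <-> ~ sval A a.
  rewrite (seen_ex _ _ (spells_input p)) AE; split.
    move=> [j H]; have Wj : W' (mkseq a j).
      by apply/(enumerates_ex _ (@binary_word_code_inj) pW').
    by apply; exists (mkseq a j) => //; apply/cylinder_mkseq; exists j.
  move=> /contrapT[w W'w /cylinder_mkseq[j aw]]; exists j; rewrite aw.
  exact/(enumerates_ex _ (@binary_word_code_inj) pW').
pose name (a : nat -> bool) : baire := fun n => nat_of_bool (a n).
have name_mkseq a j : mkseq (name a) j = map nat_of_bool (mkseq a j).
  by rewrite /mkseq -map_comp.
have inP a n : (exists d, seen_inside E d n a) <-> U n (name a).
  rewrite (seen_ex _ _ (spells_guest we)) UE; split.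
    move=> [j H]; exists (mkseq (name a) j); last by apply/cylinder_mkseq; exists j.
    by apply/(enumerates_ex _ indexed_word_code_inj eW); rewrite name_mkseq.
  move=> [w Ww /cylinder_mkseq[j aw]]; exists j; rewrite -name_mkseq aw.
  exact/(enumerates_ex _ indexed_word_code_inj eW).
have [||||||h [a [hlim nout hin]]] := @low_basis
  (fun d a => seen_outside p d a) (fun d n a => seen_inside E d n a) (guess E p).
- by move=> d d' a; exact: seen_mono.
- by move=> d d' n a; exact: seen_mono.
- by move=> d a b; exact: seen_local.
- by move=> d n a b; exact: seen_local.
- exact: guessP.
- by exists a0 => d Pd; have /outP : exists d, seen_outside p d a0 by exists d.
(* The component with index j shows at n the guess of stage <j, n> >= j. *)
exists (fun i => answer i (history E p i) : nat), a; split; first exact: MP.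
  exists (name a); split => //; apply: cvg_baire => n.
  have [D HD] := hlim n; exists D => j le_j; rewrite /component answer_pair.
  rewrite -/(guess _ _ _ _) HD; last first.
    by apply: leq_trans le_j (leq_trans (leq_addr n j) (leq_cantor_pair j n)).
  rewrite /jump; congr nat_of_bool; apply/idP/idP => [/hin/inP|].
    exact: mem_set.
  by move=> /set_mem/inP/hin.
apply: contrapT => /outP[d]; exact: nout.
Qed.
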